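(* Let $(\mathsf{H},g)$ be a semi-integrable almost hyperhermitian structure on a smooth manifold $M$ of dimension $4n$. Then $(\mathsf{H},g)$ belongs to exactly one of the following (pairwise disjoint) classes: \begin{itemize} \item Type 1: Every almost complex structure in $\mathsf{H}$ is integrable and semi-K\''ahler. \item Type 2: Up to sign there is a unique integrable complex structure in $\mathsf{H}$, and every almost complex structure in $\mathsf{H}$ is semi-K\''ahler. \item Type 3: Up to sign there is a unique integrable complex structure in $\mathsf{H}$, and the semi-K\''ahler almost complex structures in $\mathsf{H}$ are exactly the ones orthogonal to it. \item Type 4: Up to sign there are a unique integrable complex structure and a unique semi-K\''ahler almost complex structure in $\mathsf{H}$ (not necessarily distinct), and they are not orthogonal to each other. \end{itemize}
   Context: An almost hypercomplex structure on a smooth manifold $M$ of real dimension $4n$ is given by a triple $(I,J,K)$ of (globally defined) almost complex structures on $M$ satisfying $IJ=-JI=K$, and is identified with the 2-sphere of almost complex structures $\mathsf{H}=\{aI+bJ+cK \mid (a,b,c)\in S^2\}$ (constant coefficients). An almost hyperhermitian structure $(\mathsf{H},g)$ is an almost hypercomplex structure $\mathsf{H}$ together with a Riemannian metric $g$ such that $g(LX,LY)=g(X,Y)$ for every $L\in\mathsf{H}$ and all tangent vectors $X,Y$. For $L\in\mathsf{H}$ the fundamental 2-form is $\omega_L(X,Y)=g(LX,Y)$. An element $L\in\mathsf{H}$ is called semi-K\''ahler (with respect to $g$) if $\delta\omega_L=0$, where $\delta$ is the codifferential of $g$. An element of $\mathsf{H}$ is integrable if it is induced by a complex manifold structure (equivalently,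 its Nijenhuis tensor vanishes). The almost hyperhermitian structure $(\mathsf{H},g)$ is called semi-integrable if there exist $I,L\in\mathsf{H}$ (possibly equal) such that $I$ is integrable and $(L,g)$ is semi-K\''ahler. Two elements $I_1,I_2\in\mathsf{H}$ are orthogonal if $\operatorname{tr}(I_1I_2)=0$; for a triple $(I,J,K)$ of elements of $\mathsf{H}$ satisfying $IJ=-JI=K$, with $aI+bJ+cK\in\mathsf{H}$ identified with the point $(a,b,c)\in S^2$, this means that the corresponding points of $S^2\subset\mathbb{R}^3$ are orthogonal vectors. *)

(* Defs.v *)
(* Smooth manifolds are given by atlases, and tensor fields by their components
   in the charts of the atlas, subject to the tensorial transformation law.
   Points of R^m and tangent vectors are column vectors, so that an endomorphism
   of the tangent space with components L^k_l is the matrix L with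
   [L k l = L^k_l], acting on vectors by [L *m X]. *)
From HB Require Import structures.
From mathcomp Require Import all_boot all_order all_algebra.
From mathcomp Require Import all_classical all_reals all_analysis.

Set Implicit Arguments.
Unset Strict Implicit.
Unset Printing Implicit Defensive.

Import Order.TTheory GRing.Theory Num.Theory.
Import numFieldNormedType.Exports.

Local Open Scope classical_set_scope.
Local Open Scope ring_scope.

Definition partial (R : realType) (m : nat) (k : 'I_m) (f : 'cV[R]_m -> R)
  (x : 'cV[R]_m) : R := 'D_(delta_mx k 0) f x.

(* U is meant to be open. *)
Fixpoint Ck_on (R : realType) (m : nat) (r : nat) (U : set 'cV[R]_m)
    (f : 'cV[R]_m -> R) : Prop :=
  (forall x, U x -> {for x, continuous f}) /\
  match r with
  | 0%N => True
  | s.+1 => forall k : 'I_m,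
      (forall x, U x -> derivable f x (delta_mx k 0)) /\
      Ck_on s U (partial k f)
  end.

Definition smooth_on (R : realType) (m : nat) (U : set 'cV[R]_m)
  (f : 'cV[R]_m -> R) : Prop := forall r, Ck_on r U f.

Definition smooth_mx_on (R : realType) (m p q : nat) (U : set 'cV[R]_m)
  (F : 'cV[R]_m -> 'M[R]_(p, q)) : Prop :=
  forall (k : 'I_p) (l : 'I_q), smooth_on U (fun x => F x k l).

Definition jacobian (R : realType) (m : nat) (F : 'cV[R]_m -> 'cV[R]_m)
  (x : 'cV[R]_m) : 'M[R]_m :=
  \matrix_(k, l) partial l (fun y => F y k 0) x.

(* [chart_map i] matters only on [chart_dom i], and [chart_inv i] only on the
   image of [chart_dom i]. *)
Record smoothManifold (R : realType) (m : nat) := SmoothManifold {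
  carrier :> topologicalType;
  carrier_hausdorff : hausdorff_space carrier;
  carrier_second_countable : @second_countable carrier;
  chart_index : Type;
  chart_dom : chart_index -> set carrier;
  chart_map : chart_index -> carrier -> 'cV[R]_m;
  chart_inv : chart_index -> 'cV[R]_m -> carrier;
  chart_dom_open : forall i, open (chart_dom i);
  chart_img_open : forall i, open (chart_map i @` chart_dom i);
  chart_mapK : forall i p, chart_dom i p -> chart_inv i (chart_map i p) = p;
  chart_map_continuous : forall i p, chart_dom i p ->
    {for p, continuous (chart_map i)};
  chart_inv_continuous : forall i p, chart_dom i p ->
    {for chart_map i p, continuous (chart_inv i)};
  chart_cover : forall p, exists i, chart_dom i p;
  chart_compat : forall i j,
    smooth_mx_on (chart_map i @` (chart_dom i `&` chart_dom j))
      (fun x => chart_map j (chart_inv i x))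
}.

Section Tensors.
Variables (R : realType) (m : nat) (M : smoothManifold R m).
Local Notation idx := (chart_index M).

Definition chart_img (i : idx) : set 'cV[R]_m :=
  chart_map i @` chart_dom i.

Definition chart_overlap (i j : idx) : set 'cV[R]_m :=
  chart_map i @` (chart_dom i `&` chart_dom j).

Definition transition (i j : idx) (x : 'cV[R]_m) : 'cV[R]_m :=
  chart_map j (chart_inv i x).

(* Components in every chart, as functions of the coordinates. *)
Definition tensor2 : Type := idx -> 'cV[R]_m -> 'M[R]_m.

(* Tensor fields of type (1,1). The components are normalized to be 0 outside
   the chart image, so that Leibniz equality is equality of fields on M. *)
Definition endo_field (L : tensor2) : Prop :=
  [/\ forall i, smooth_mx_on (chart_img i) (L i),
      forall i j x, chart_overlap i j x ->
        L j (transition i j x) *m jacobian (transition i j) x =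
        jacobian (transition i j) x *m L i x
    & forall i x, ~ chart_img i x -> L i x = 0].

Definition bilin (B : 'M[R]_m) (X Y : 'cV[R]_m) : R :=
  (X^T *m B *m Y) 0 0.

Definition riemannian_metric (g : tensor2) : Prop :=
  [/\ forall i, smooth_mx_on (chart_img i) (g i),
      forall i j x, chart_overlap i j x -> forall X Y,
        bilin (g j (transition i j x)) (jacobian (transition i j) x *m X)
              (jacobian (transition i j) x *m Y) = bilin (g i x) X Y,
      forall i x, chart_img i x -> forall X Y,
        bilin (g i x) X Y = bilin (g i x) Y X
    & forall i x, chart_img i x -> forall X, X != 0 -> 0 < bilin (g i x) X X].

Definition almost_complex (L : tensor2) : Prop :=
  endo_field L /\
  forall i x, chart_img i x -> L i x *m L i x = - 1%:M.

Definition oppT (L : tensor2) : tensor2 := fun i x => - L i x.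

Definition lincomb3 (a b c : R) (I J K : tensor2) : tensor2 :=
  fun i x => a *: I i x + b *: J i x + c *: K i x.

Definition almost_hypercomplex (H : set tensor2) : Prop :=
  exists I J K : tensor2,
    [/\ almost_complex I, almost_complex J, almost_complex K,
        forall i x, chart_img i x ->
          I i x *m J i x = K i x /\ - (J i x *m I i x) = K i x
      & H = [set L | exists a b c : R,
               a ^+ 2 + b ^+ 2 + c ^+ 2 = 1 /\ L = lincomb3 a b c I J K]].

Definition almost_hyperhermitian (H : set tensor2) (g : tensor2) : Prop :=
  [/\ almost_hypercomplex H, riemannian_metric g
    & forall L, H L -> forall i x, chart_img i x -> forall X Y,
        bilin (g i x) (L i x *m X) (L i x *m Y) = bilin (g i x) X Y].

(* Components of the 2-form omega_L(X,Y) = g(LX,Y). *)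
Definition fundamental_form (g L : tensor2) : tensor2 :=
  fun i x => \matrix_(k, l)
    bilin (g i x) (L i x *m delta_mx k 0) (delta_mx l 0).

(* Christoffel symbol Gamma^k_{ab} of the Levi-Civita connection of g. *)
Definition christoffel (g : tensor2) (i : idx) (x : 'cV[R]_m)
    (k a b : 'I_m) : R :=
  2^-1 * \sum_(l < m) invmx (g i x) k l *
    (partial a (fun y => g i y b l) x + partial b (fun y => g i y a l) x
     - partial l (fun y => g i y a b) x).

(* (nabla_c w)_{ab} for a covariant 2-tensor w. *)
Definition covder (g w : tensor2) (i : idx) (x : 'cV[R]_m)
    (c a b : 'I_m) : R :=
  partial c (fun y => w i y a b) x
  - \sum_(s < m) christoffel g i x s c a * w i x s b
  - \sum_(s < m) christoffel g i x s c b * w i x a s.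

(* Codifferential of a 2-form: (delta w)_b = - g^{ca} (nabla_c w)_{ab}. *)
Definition codiff (g w : tensor2) (i : idx) (x : 'cV[R]_m) (b : 'I_m) : R :=
  - \sum_(c < m) \sum_(a < m) invmx (g i x) c a * covder g w i x c a b.

Definition semi_kahler (g L : tensor2) : Prop :=
  forall i x, chart_img i x -> forall b, codiff g (fundamental_form g L) i x b = 0.

(* Lie bracket of vector fields in coordinates:
   [X,Y]^k = X^l d_l Y^k - Y^l d_l X^k. *)
Definition lie_bracket (X Y : 'cV[R]_m -> 'cV[R]_m) (x : 'cV[R]_m) : 'cV[R]_m :=
  \col_(k < m) \sum_(l < m)
    (X x l 0 * partial l (fun y => Y y k 0) x
     - Y x l 0 * partial l (fun y => X y k 0) x).

Definition nijenhuis (L : 'cV[R]_m -> 'M[R]_m) (X Y : 'cV[R]_m -> 'cV[R]_m)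
    (x : 'cV[R]_m) : 'cV[R]_m :=
  let LX y := L y *m X y in
  let LY y := L y *m Y y in
  lie_bracket LX LY x - L x *m lie_bracket LX Y x
  - L x *m lie_bracket X LY x - lie_bracket X Y x.

(* Integrability of an almost complex structure, as vanishing of its Nijenhuis
   tensor on all smooth vector fields on the domains of the charts. *)
Definition integrable (L : tensor2) : Prop :=
  forall i (X Y : 'cV[R]_m -> 'cV[R]_m),
    smooth_mx_on (chart_img i) X -> smooth_mx_on (chart_img i) Y ->
    forall x, chart_img i x -> nijenhuis (L i) X Y x = 0.

Definition orthogonal (L1 L2 : tensor2) : Prop :=
  forall i x, chart_img i x -> \tr (L1 i x *m L2 i x) = 0.

Definition semi_integrable (H : set tensor2) (g : tensor2) : Prop :=
  exists I L : tensor2, [/\ H I, H L, integrable I & semi_kahler g L].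

Definition unique_up_to_sign (H : set tensor2) (P : tensor2 -> Prop)
    (L : tensor2) : Prop :=
  [/\ H L, P L & forall L', H L' -> P L' -> L' = L \/ L' = oppT L].

Inductive structure_type := Type1 | Type2 | Type3 | Type4.

Definition of_type (H : set tensor2) (g : tensor2) (t : structure_type) : Prop :=
  match t with
  | Type1 => forall L, H L -> integrable L /\ semi_kahler g L
  | Type2 => (exists I, unique_up_to_sign H integrable I) /\
             (forall L, H L -> semi_kahler g L)
  | Type3 => exists I, unique_up_to_sign H integrable I /\
             (forall L, H L -> (semi_kahler g L <-> orthogonal L I))
  | Type4 => exists I L, [/\ unique_up_to_sign H integrable I,
               unique_up_to_sign H (semi_kahler g) L & ~ orthogonal L I]
  end.

End Tensors.

(* Main.v *)
Require Import Defs.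
From HB Require Import structures.
From mathcomp Require Import all_boot all_order all_algebra.
From mathcomp Require Import all_classical all_reals all_analysis.
From mathcomp Require Import ring lra.

Set Implicit Arguments.
Unset Strict Implicit.
Unset Printing Implicit Defensive.

Import Order.TTheory GRing.Theory Num.Theory.
Import numFieldNormedType.Exports.

Local Open Scope classical_set_scope.
Local Open Scope ring_scope.

(** Everything rests on the Levi-Civita connection [nabla] of [g] and on two
    facts about orthogonal elements [I], [J] of [H], with [K = I J].

    - If [I] is integrable and [J] is semi-Kaehler, so is [K]
      ([semi_kahler_mul]).
    - If [I] and [a I + b J] are integrable with [b != 0], then every element of
      [H] is integrable ([integrable_all]).

    Both use that a hermitian structure [L] is integrable exactly when
    [nabla_(L v) L = L (nabla_v L)] for all [v] ([integrable_cauchy_riemann]):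
    the Nijenhuis tensor vanishes exactly when
    [B v = nabla_(L v) L - L (nabla_v L)] satisfies [B u w = B w u], and
    since [B v] is also skew-adjoint for [g], this forces [B = 0].

    For the first fact, [delta omega_L] is dual to minus the trace over the
    metric of [v |-> (nabla_v L) v], and [nabla K = (nabla I) J + I (nabla J)].
    The trace of [(nabla I) J] vanishes, because replacing [v] by [I v], which
    does not change a metric trace, changes its sign when [I] satisfies the
    equation above.

    For the second fact, put [{U, V} = U (nabla V) + (nabla V) U]. Differentiating
    the quaternion relations shows that this is antisymmetric in [U] and [V] on
    anticommuting elements, so that it amounts to three endomorphism-valued
    one-forms, one for each of the pairs [(J, I)], [(K, J)] and [(I, K)].
    Integrability of [I] reads [{J, I} (I v) = - {K, I} v], and that of [J] reads
    [{J, I} (J v) = - {K, J} v]: the left-hand sides involve the same form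
    [{J, I}]. Adding multiples of the two equations gives the one for
    [a I + b J], so that the latter and the equation for [I] imply the one for
    [J] when [b != 0]; the equation for [K] follows from those for [I] and [J].

    The semi-Kaehler condition is linear, so it cuts out a linear subspace of the
    three-dimensional space spanned by [I], [J], [K]. By the first fact, if [I] is
    integrable and this subspace contains a nonzero vector of the plane orthogonal
    to [I], it contains that plane. The dimension of the subspace then separates the types 2, 3
    and 4 when [I] is unique up to sign. When there is another integrable
    structure, all structures are integrable by the second fact, and the first
    one, applied with varying [I], makes the subspace the whole space. *)

(** * Directional derivatives of matrix-valued functions *)

Section DirectionalDerivative.
Variables (R : realType) (m : nat).
Local Notation vec := 'cV[R]_m.

(** Differentiability is only asked along the coordinate directions, which is
    what smoothness provides directly; [dird] is accordingly defined as the
    combination of partial derivatives, hence linear in the direction [v]. *)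
Definition pderivable p q (F : vec -> 'M[R]_(p, q)) (x : vec) : Prop :=
  forall c : 'I_m, derivable F x (delta_mx c 0).

Definition dird p q (F : vec -> 'M[R]_(p, q)) (x v : vec) : 'M[R]_(p, q) :=
  \sum_(c < m) v c 0 *: 'D_(delta_mx c 0) F x.

Lemma smooth_pderivable p q (F : vec -> 'M[R]_(p, q)) U x :
  smooth_mx_on U F -> U x -> pderivable F x.
Proof.
move=> sF Ux c; apply/derivable_mxP => k l.
by have [_ /(_ c)[+ _]] := sF k l 1%N; apply.
Qed.

Lemma smooth_cst p q (A : 'M[R]_(p, q)) (U : set vec) : smooth_mx_on U (cst A).
Proof.
move=> k l r; rewrite [X in Ck_on _ _ X](_ : _ = cst (A k l))//.
elim: r (A k l) => [|r IH] a /=; (split; first by move=> x _; exact: cst_continuous).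
  by [].
move=> c; split; first by move=> x _; exact: derivable_cst.
rewrite (_ : partial c _ = cst 0)//; apply/funext => x.
exact: derive_cst.
Qed.

Lemma partialE p q (F : vec -> 'M[R]_(p, q)) x c k l : pderivable F x ->
  partial c (fun y => F y k l) x = 'D_(delta_mx c 0) F x k l.
Proof. by move=> dF; rewrite (derive_mx (dF c)) mxE. Qed.

Lemma dird_delta p q (F : vec -> 'M[R]_(p, q)) x c :
  dird F x (delta_mx c 0) = 'D_(delta_mx c 0) F x.
Proof.
rewrite /dird (bigD1 c)//= big1 ?addr0 => [|d dc]; first by rewrite mxE !eqxx scale1r.
by rewrite mxE (negbTE dc) scale0r.
Qed.

Lemma dirdE p q (F : vec -> 'M[R]_(p, q)) x v k l : pderivable F x ->
  dird F x v k l = \sum_(c < m) v c 0 * partial c (fun y => F y k l) x.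
Proof.
move=> dF; rewrite /dird summxE; apply: eq_bigr => c _.
by rewrite mxE (partialE _ _ _ dF).
Qed.

Lemma dird_is_linear p q (F : vec -> 'M[R]_(p, q)) x : linear (dird F x).
Proof.
move=> a u v; rewrite /dird scaler_sumr -big_split/=; apply: eq_bigr => c _.
by rewrite !mxE scalerDl scalerA.
Qed.

HB.instance Definition _ p q (F : vec -> 'M[R]_(p, q)) x :=
  GRing.isLinear.Build R vec 'M[R]_(p, q) _ (dird F x) (dird_is_linear F x).

Lemma near_eq_dird p q (F G : vec -> 'M[R]_(p, q)) x v :
  (\near x, F x = G x) -> dird F x v = dird G x v.
Proof.
by move=> FG; apply: eq_bigr => c _; rewrite (near_eq_derive _ FG).
Qed.

Section Calculus.
Variables (p q r : nat) (x : vec).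
Implicit Types (F G : vec -> 'M[R]_(p, q)) (N : vec -> 'M[R]_(q, r)).

Lemma pderivable_cst (A : 'M[R]_(p, q)) : pderivable (cst A) x.
Proof. by move=> c; exact: derivable_cst. Qed.

Lemma dird_cst (A : 'M[R]_(p, q)) v : dird (cst A) x v = 0.
Proof. by rewrite /dird big1// => c _; rewrite derive_cst scaler0. Qed.

Lemma pderivableD F G : pderivable F x -> pderivable G x ->
  pderivable (fun y => F y + G y) x.
Proof. by move=> dF dG c; exact: derivableD (dF c) (dG c). Qed.

Lemma dirdD F G v : pderivable F x -> pderivable G x ->
  dird (fun y => F y + G y) x v = dird F x v + dird G x v.
Proof.
move=> dF dG; rewrite /dird -big_split/=; apply: eq_bigr => c _.
by rewrite -scalerDr -(deriveD (dF c) (dG c)).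
Qed.

Lemma pderivableZ a F : pderivable F x -> pderivable (fun y => a *: F y) x.
Proof. by move=> dF c; exact: derivableZ (dF c). Qed.

Lemma dirdZ a F v : pderivable F x ->
  dird (fun y => a *: F y) x v = a *: dird F x v.
Proof.
move=> dF; rewrite /dird scaler_sumr; apply: eq_bigr => c _.
by rewrite scalerA mulrC -scalerA -(deriveZ a (dF c)).
Qed.

Lemma is_derive_mulmx F N v dF dN : is_derive x v F dF -> is_derive x v N dN ->
  is_derive x v (fun y => F y *m N y) (dF *m N x + F x *m dN).
Proof.
move=> [dFx <-] [dNx <-].
have dk k l (j : 'I_q) : is_derive x v (fun y => F y k j * N y j l)
    (F x k j * 'D_v N x j l + N x j l * 'D_v F x k j).
  have dF1 := (derivable_mxP _ _ _).1 dFx k j.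
  have dN1 := (derivable_mxP _ _ _).1 dNx j l.
  have := is_deriveM (derivableP dF1) (derivableP dN1).
  by rewrite (derive_mx dFx) (derive_mx dNx) !mxE.
have ds k l : is_derive x v (fun y => (F y *m N y) k l)
    (('D_v F x *m N x + F x *m 'D_v N x) k l).
  have := is_derive_sum (dk k l).
  congr is_derive.
    by apply/funext => y; rewrite fct_sumE mxE.
  by rewrite big_split !mxE/= addrC; congr +%R; apply: eq_bigr => j _; rewrite mulrC.
have dFN : derivable (fun y => F y *m N y) x v.
  by apply/derivable_mxP => k l; have [] := ds k l.
apply: DeriveDef => //.
rewrite (derive_mx dFN); apply/matrixP => k l; rewrite mxE.
by have [_ ->] := ds k l.
Qed.

Lemma pderivableM F N : pderivable F x -> pderivable N x ->
  pderivable (fun y => F y *m N y) x.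
Proof.
by move=> dF dN c; have [] := is_derive_mulmx (derivableP (dF c)) (derivableP (dN c)).
Qed.

Lemma dirdM F N v : pderivable F x -> pderivable N x ->
  dird (fun y => F y *m N y) x v = dird F x v *m N x + F x *m dird N x v.
Proof.
move=> dF dN; rewrite /dird mulmx_suml mulmx_sumr -big_split/=.
apply: eq_bigr => c _.
have [_ ->] := is_derive_mulmx (derivableP (dF c)) (derivableP (dN c)).
by rewrite scalerDr scalemxAl -scalemxAr.
Qed.

Lemma pderivable_tr F : pderivable F x -> pderivable (fun y => (F y)^T) x.
Proof.
move=> dF c; apply/derivable_mxP => k l.
rewrite (_ : (fun _ => _) = (fun y => F y l k)); last by apply/funext => y; rewrite mxE.
exact: (derivable_mxP _ _ _).1 (dF c) l k.
Qed.

Lemma dird_tr F v : pderivable F x ->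
  dird (fun y => (F y)^T) x v = (dird F x v)^T.
Proof.
move=> dF; apply/matrixP => k l.
rewrite mxE (dirdE _ _ _ (pderivable_tr dF)) (dirdE _ _ _ dF).
apply: eq_bigr => c _; congr (_ * partial _ _ _).
by apply/funext => y; rewrite mxE.
Qed.

End Calculus.
End DirectionalDerivative.

(** * The Levi-Civita connection in a chart *)

(** Closes an equation between linear combinations of matrices, treating
    matrix products and directional derivatives as atoms. The products must first
    be brought to the same instance of the coefficient ring, since otherwise
    equal products could become distinct atoms. *)
Ltac matrix_module :=
  match goal with R : realType |- _ =>
    repeat match goal with |- context [@mulmx ?S ?a ?b ?c] =>
      progress change (@mulmx S a b c) with (@mulmx R a b c) end;
    apply/matrixP => ? ?;
    repeat match goal with
    | |- context [@mulmx R ?a ?b ?c ?A ?B] => generalize (@mulmx R a b c A B); intro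
    | |- context [@dird R ?m ?p ?q ?F ?x ?v] => generalize (@dird R m p q F x v); intro
    end;
    rewrite !mxE; ring
  end.

Section LeviCivita.
Variables (R : realType) (m : nat) (M : smoothManifold R m).
Implicit Types L N w : tensor2 M.

Lemma bilin_delta (B : 'M[R]_m) a b :
  bilin B (delta_mx a 0) (delta_mx b 0) = B a b.
Proof. by rewrite /bilin trmx_delta -rowE -colE !mxE. Qed.

Lemma bilin_inj (A B : 'M[R]_m) :
  (forall X Y, bilin A X Y = bilin B X Y) -> A = B.
Proof. by move=> AB; apply/matrixP => a b; rewrite -!bilin_delta. Qed.

(** With [L] acting on column vectors, [g (L X, Y) = X^T L^T g Y]. *)
Lemma fundamental_formE (g L : tensor2 M) :
  fundamental_form g L = fun j y => (L j y)^T *m g j y.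
Proof.
apply/funext => j; apply/funext => y; apply/matrixP => k l.
by rewrite mxE -bilin_delta /bilin trmx_mul -!mulmxA.
Qed.

Variables (g : tensor2 M) (i : chart_index M) (x : 'cV[R]_m).
Hypotheses (metric_g : riemannian_metric g) (ix : chart_img i x).

(** The matrix [w |-> Gamma (v, w)], so that the covariant derivative of a
    vector field [w] along [v] is [dird w x v + christoffel_mx v *m w]. *)
Definition christoffel_mx (v : 'cV[R]_m) : 'M[R]_m :=
  \sum_(c < m) v c 0 *: \matrix_(k, b) christoffel g i x k c b.

(** The commutator with the connection matrix is the action of the connection
    on endomorphism fields. *)
Definition nabla L (v : 'cV[R]_m) : 'M[R]_m :=
  dird (L i) x v + christoffel_mx v *m L i x - L i x *m christoffel_mx v.

Lemma chart_img_near (P : 'cV[R]_m -> Prop) :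
  (forall y, chart_img i y -> P y) -> \near x, P x.
Proof.
move=> chartP; have : nbhs x (chart_img i).
  by apply: open_nbhs_nbhs; split => //; exact: chart_img_open.
exact: filterS.
Qed.

Lemma metric_pderivable : pderivable (g i) x.
Proof. by have [/(_ i) sg _ _ _] := metric_g; exact: smooth_pderivable ix. Qed.

Lemma riemannian_sym y : chart_img i y -> (g i y)^T = g i y.
Proof.
have [_ _ sg _] := metric_g => iy; apply/matrixP => a b.
by rewrite mxE -bilin_delta sg// bilin_delta.
Qed.

(** A vector in the kernel of [g] would have length zero. *)
Lemma metric_unit : g i x \in unitmx.
Proof.
have [_ _ _ pg] := metric_g.
rewrite -row_free_unit -kermx_eq0; apply/rowV0P => v /sub_kermxP vg.
apply/eqP; apply: contraT => v0; have := pg i x ix v^T.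
rewrite -trmx0 (inj_eq trmx_inj) => /(_ v0).
by rewrite /bilin trmxK vg mul0mx mxE ltxx.
Qed.

Lemma partial_riemannian_sym c a b :
  partial c (fun y => g i y a b) x = partial c (fun y => g i y b a) x.
Proof.
apply: near_eq_derive; apply: chart_img_near => y iy.
by rewrite -[in LHS](riemannian_sym iy) mxE.
Qed.

Lemma christoffel_sym k a b : christoffel g i x k a b = christoffel g i x k b a.
Proof.
rewrite /christoffel; congr (_ * _); apply: eq_bigr => l _.
by rewrite (partial_riemannian_sym l a b) [X in _ * (X - _)]addrC.
Qed.

(** Torsion-freeness. *)
Lemma christoffel_mx_sym u v : christoffel_mx u *m v = christoffel_mx v *m u.
Proof.
have E (p q : 'cV[R]_m) k : (christoffel_mx p *m q) k 0 =
    \sum_c \sum_b p c 0 * q b 0 * christoffel g i x k c b.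
  rewrite mxE exchange_big/=; apply: eq_bigr => b _.
  rewrite summxE mulr_suml; apply: eq_bigr => c _.
  by rewrite !mxE mulrAC.
apply/matrixP => k j; rewrite ord1 !E exchange_big/=.
apply: eq_bigr => b _; apply: eq_bigr => c _.
by rewrite (christoffel_sym k c b) (mulrC (u c 0)).
Qed.

(** Lowering the upper index cancels the inverse metric in the definition
    and leaves the Christoffel symbols of the first kind. *)
Lemma christoffel_lower c b d :
  \sum_k g i x d k * christoffel g i x k c b =
  2^-1 * (partial c (fun y => g i y b d) x + partial b (fun y => g i y c d) x
          - partial d (fun y => g i y c b) x).
Proof.
transitivity (2^-1 * \sum_l (g i x *m invmx (g i x)) d l *
   (partial c (fun y => g i y b l) x + partial b (fun y => g i y c l) x
     - partial l (fun y => g i y c b) x)).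
  rewrite mulr_sumr.
  under eq_bigr do rewrite /christoffel mulrCA mulr_sumr mulr_sumr.
  rewrite exchange_big/=; apply: eq_bigr => l _.
  rewrite mxE mulr_suml mulr_sumr; apply: eq_bigr => k _.
  by rewrite !mulrA.
rewrite mulmxV ?metric_unit// (bigD1 d)//= big1 ?addr0 => [|l ld].
  by rewrite mxE eqxx mul1r.
by rewrite mxE eq_sym (negbTE ld) mul0r.
Qed.

Lemma metric_mul_christoffel_mx v d b : (g i x *m christoffel_mx v) d b =
  \sum_c v c 0 * \sum_k g i x d k * christoffel g i x k c b.
Proof.
rewrite /christoffel_mx mulmx_sumr summxE; apply: eq_bigr => c _.
rewrite -scalemxAr !mxE; congr (_ * _); apply: eq_bigr => k _.
by rewrite mxE.
Qed.

(** The metric is parallel: in the sum of two Christoffel symbols of the first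
    kind, all derivatives cancel except that of [g] along [v]. *)
Lemma metric_parallel v :
  dird (g i) x v = (christoffel_mx v)^T *m g i x + g i x *m christoffel_mx v.
Proof.
rewrite -[X in _ *m X + _](riemannian_sym ix) -trmx_mul.
apply/matrixP => d b; rewrite [RHS]mxE [X in X + _]mxE.
rewrite !metric_mul_christoffel_mx (dirdE _ _ _ metric_pderivable) -big_split/=.
apply: eq_bigr => c _; rewrite !christoffel_lower -mulrDr; congr (_ * _).
rewrite (partial_riemannian_sym d c b) (partial_riemannian_sym b c d).
rewrite (partial_riemannian_sym c b d).
by lra.
Qed.

Lemma nabla_is_linear L : linear (nabla L).
Proof.
have lG : linear christoffel_mx.
  move=> a u v; rewrite /christoffel_mx scaler_sumr -big_split/=.
  by apply: eq_bigr => c _; rewrite !mxE scalerDl scalerA.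
move=> a u v; rewrite /nabla lG linearP/= mulmxDl mulmxDr -scalemxAl -scalemxAr.
by matrix_module.
Qed.

HB.instance Definition _ L :=
  GRing.isLinear.Build R 'cV[R]_m 'M[R]_m _ (nabla L) (nabla_is_linear L).

Section NablaCalculus.
Variables (L N : tensor2 M).
Hypotheses (dL : pderivable (L i) x) (dN : pderivable (N i) x).

Lemma nabla_eq L' v : (\near x, L i x = L' i x) -> nabla L v = nabla L' v.
Proof. by move=> LL'; rewrite /nabla (near_eq_dird v LL') (nbhs_singleton LL'). Qed.

Lemma nablaD v : nabla (fun j y => L j y + N j y) v = nabla L v + nabla N v.
Proof. by rewrite /nabla dirdD// mulmxDr mulmxDl; matrix_module. Qed.

Lemma nablaZ a v : nabla (fun j y => a *: L j y) v = a *: nabla L v.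
Proof. by rewrite /nabla dirdZ// -scalemxAl -scalemxAr; matrix_module. Qed.

Lemma nablaM v : nabla (fun j y => L j y *m N j y) v =
  nabla L v *m N i x + L i x *m nabla N v.
Proof.
rewrite /nabla dirdM// !mulmxBl !mulmxBr !mulmxDl !mulmxDr !mulmxA.
by matrix_module.
Qed.

Lemma nabla_scalar a v : nabla (fun _ _ => a%:M) v = 0.
Proof. by rewrite /nabla dird_cst add0r scalar_mxC subrr. Qed.

End NablaCalculus.

Section Codifferential.
Variable L : tensor2 M.
Hypothesis dL : pderivable (L i) x.

(** Since [omega_L] is obtained from [L] by lowering an index with the
    parallel tensor [g], its covariant derivative is that of [L] lowered. *)
Lemma covder_fundamental_form c a b :
  covder g (fundamental_form g L) i x c a b =
  ((nabla L (delta_mx c 0))^T *m g i x) a b.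
Proof.
rewrite fundamental_formE.
have Gc : christoffel_mx (delta_mx c 0) = \matrix_(k, b) christoffel g i x k c b.
  rewrite /christoffel_mx (bigD1 c)//= big1 ?addr0 => [|d dc].
    by rewrite mxE !eqxx scale1r.
  by rewrite mxE (negbTE dc) scale0r.
set w := (L i x)^T *m g i x.
have dLt := pderivable_tr dL; have dg := metric_pderivable.
transitivity ((dird (fun y => (L i y)^T *m g i y) x (delta_mx c 0) -
   (christoffel_mx (delta_mx c 0))^T *m w - w *m christoffel_mx (delta_mx c 0)) a b).
  rewrite /covder Gc dird_delta (partialE _ _ _ (pderivableM dLt dg)).
  rewrite !mxE; congr (_ - _ - _).
    by apply: eq_bigr => s _; rewrite /w !mxE.
  by apply: eq_bigr => s _; rewrite /w !mxE mulrC.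
congr (fun_of_matrix _ a b); rewrite /w dirdM// dird_tr// metric_parallel /nabla.
move: (dird _ _ _) (christoffel_mx _) (L i x) (g i x) => D G A h.
have -> : (D + G *m A - A *m G)^T = D^T + A^T *m G^T - G^T *m A^T.
  by rewrite linearB linearD/= !trmx_mul.
by rewrite mulmxBl mulmxDl mulmxDr !mulmxA; matrix_module.
Qed.

End Codifferential.
End LeviCivita.

(** * The codifferential and the Nijenhuis tensor of a hermitian structure *)

Section PointwiseAlgebra.
Variables (R : realType) (m : nat).

Lemma eq_mulmx_cV (A B : 'M[R]_m) : (forall X : 'cV_m, A *m X = B *m X) -> A = B.
Proof.
move=> AB; apply/matrixP => k l; have /matrixP/(_ k 0) := AB (delta_mx l 0).
by rewrite -!colE !mxE.
Qed.

(** A trilinear form that is symmetric in its first two and skew in its last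
    two arguments vanishes: alternating the two symmetries six times returns to
    the initial order of the arguments with the opposite sign. *)
Lemma symmetric_skew_eq0 (h : 'M[R]_m) (B : 'cV[R]_m -> 'M[R]_m) :
  h \in unitmx -> h^T = h -> (forall X Y, B X *m Y = B Y *m X) ->
  (forall X, (B X)^T *m h = - (h *m B X)) -> forall X, B X = 0.
Proof.
move=> hU hT Bsym Bskew X.
pose S U V W : 'M[R]_1 := W^T *m h *m (B U *m V).
have Ssym U V W : S U V W = S V U W by rewrite /S Bsym.
have Sskew U V W : S U V W = - S U W V.
  have -> : S U V W = (S U V W)^T by apply/matrixP => a b; rewrite [RHS]mxE !ord1.
  rewrite /S !trmx_mul trmxK hT !mulmxA -(mulmxA V^T _^T) Bskew.
  by rewrite mulmxN !mulNmx !mulmxA.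
have S0 U V W : S U V W = 0.
  have E : S U V W = - S U V W.
    rewrite [LHS]Ssym [LHS]Sskew [in LHS](Ssym V W) [in LHS](Sskew W V).
    by rewrite [in LHS](Ssym W U) [in LHS](Sskew U W) !opprK.
  move: (S U V W) E => s sN; apply/matrixP => a b.
  by move/matrixP/(_ a b): sN; rewrite !mxE; lra.
apply: eq_mulmx_cV => Y; rewrite mul0mx; apply: (can_inj (mulKmx hU)); rewrite mulmx0.
apply/row_matrixP => a; rewrite row0 rowE -(S0 X Y (delta_mx a 0)).
by rewrite /S trmx_delta mulmxA.
Qed.

(** For [N] the inverse metric this is the metric trace of [v |-> P v v]. The
    general [N] allows a factor on the right of [P] to be moved into [N]. *)
Definition metric_trace (P : 'cV[R]_m -> 'M[R]_m) (N : 'M[R]_m) : 'cV[R]_m :=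
  \sum_(c < m) P (delta_mx c 0) *m N *m delta_mx c 0.

Lemma eq_metric_trace P Q N : P =1 Q -> metric_trace P N = metric_trace Q N.
Proof. by move=> PQ; apply: eq_bigr => c _; rewrite PQ. Qed.

Lemma metric_traceD P Q N :
  metric_trace (fun v => P v + Q v) N = metric_trace P N + metric_trace Q N.
Proof.
by rewrite -big_split; apply: eq_bigr => c _; rewrite !mulmxDl.
Qed.

Lemma metric_traceZ a P N : metric_trace (fun v => a *: P v) N = a *: metric_trace P N.
Proof.
by rewrite scaler_sumr; apply: eq_bigr => c _; rewrite !scalemxAl.
Qed.

Lemma metric_trace_mull A P N :
  metric_trace (fun v => A *m P v) N = A *m metric_trace P N.
Proof. by rewrite mulmx_sumr; apply: eq_bigr => c _; rewrite !mulmxA. Qed.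

Lemma metric_trace_mulr A P N :
  metric_trace (fun v => P v *m A) N = metric_trace P (A *m N).
Proof. by apply: eq_bigr => c _; rewrite !mulmxA. Qed.

(** Substituting [A v] for the differentiation direction is, after exchanging
    the two summations, the same as multiplying the other slot by [A^T]. *)
Lemma metric_trace_comp (P : {linear 'cV[R]_m -> 'M[R]_m}) (A N : 'M[R]_m) :
  metric_trace (fun v => P (A *m v)) N = metric_trace P (N *m A^T).
Proof.
have colE' (B : 'M[R]_m) d : B *m delta_mx d 0 = \sum_e B e d *: (delta_mx e 0 : 'cV_m).
  rewrite -colE; apply/matrixP => k l; rewrite ord1 summxE mxE (bigD1 k)//= big1.
    by rewrite !mxE !eqxx mulr1 addr0.
  by move=> e ek; rewrite !mxE eq_sym (negbTE ek) mulr0.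
rewrite /metric_trace.
under eq_bigr => c _ do rewrite /= (colE' A) linear_sum !mulmx_suml.
rewrite exchange_big/=; apply: eq_bigr => e _.
rewrite -!mulmxA (colE' A^T) !mulmx_sumr; apply: eq_bigr => c _.
by rewrite mxE linearZ/= -!scalemxAl -!scalemxAr mulmxA.
Qed.

End PointwiseAlgebra.

Section HermitianStructures.
Variables (R : realType) (m : nat) (M : smoothManifold R m).

(** The last equation says that [L] is skew-adjoint for [g], which for
    [L ^ 2 = - 1] is equivalent to [L] being orthogonal. Unlike orthogonality it is
    linear in [L], and easier to differentiate. *)
Definition hermitian_structure (g L : tensor2 M) : Prop :=
  forall i x, chart_img i x ->
    [/\ pderivable (L i) x, L i x *m L i x = - 1%:M
      & (L i x)^T *m g i x = - (g i x *m L i x)].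

(** For a hermitian structure this turns out to be integrability at [x]; unlike
    the Nijenhuis tensor it is free of vector fields and involves a single
    derivative of [L] on each side. *)
Definition cauchy_riemann (g L : tensor2 M) (i : chart_index M) (x : 'cV[R]_m) :=
  forall v, nabla g i x L (L i x *m v) = L i x *m nabla g i x L v.

Section AtAPoint.
Variables (g : tensor2 M) (i : chart_index M) (x : 'cV[R]_m).
Hypotheses (metric_g : riemannian_metric g) (ix : chart_img i x).
Local Notation nabla := (nabla g i x).

(** The divergence of [omega_L] is, up to sign, dual to the metric trace of
    [nabla L]. *)
Lemma codiff_fundamental_form (L : tensor2 M) b : pderivable (L i) x ->
  codiff g (fundamental_form g L) i x b =
  - ((metric_trace (nabla L) (invmx (g i x)))^T *m g i x) 0 b.
Proof.
move=> dL; rewrite /codiff; congr (- _); rewrite mxE.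
under eq_bigr => c _ do under eq_bigr => a _ do
  rewrite (covder_fundamental_form metric_g ix dL) mxE mulr_sumr.
under eq_bigr => c _ do rewrite exchange_big/=.
rewrite exchange_big/=; apply: eq_bigr => s _.
rewrite mxE /metric_trace summxE mulr_suml; apply: eq_bigr => c _.
rewrite -mulmxA -[invmx _ *m _]colE mxE mulr_suml; apply: eq_bigr => a _.
have GT : (invmx (g i x))^T = invmx (g i x) by rewrite trmx_inv (riemannian_sym metric_g ix).
by rewrite -[in LHS]GT !mxE mulrCA mulrA.
Qed.

Lemma lie_bracketE (X Y : 'cV[R]_m -> 'cV[R]_m) : pderivable X x -> pderivable Y x ->
  lie_bracket X Y x = dird Y x (X x) - dird X x (Y x).
Proof.
move=> dX dY; apply/matrixP => k j; rewrite ord1 !mxE sumrB.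
by rewrite (dirdE _ _ _ dX) (dirdE _ _ _ dY).
Qed.

(** The derivatives of [X] and [Y] cancel because [L ^ 2 = - 1], and the
    connection matrices do so because the connection is torsion-free. Hence
    the Nijenhuis tensor is the antisymmetrization of [B u v], where
    [B u = nabla_(L u) L - L (nabla_u L)]. *)
Lemma nijenhuis_nabla (L : tensor2 M) (X Y : 'cV[R]_m -> 'cV[R]_m) :
  hermitian_structure g L -> pderivable X x -> pderivable Y x ->
  nijenhuis (L i) X Y x =
  (nabla L (L i x *m X x) - L i x *m nabla L (X x)) *m Y x
  - (nabla L (L i x *m Y x) - L i x *m nabla L (Y x)) *m X x.
Proof.
move=> herm dX dY; have [dL LL _] := herm i x ix.
have dLX := pderivableM dL dX; have dLY := pderivableM dL dY.
rewrite /nijenhuis !lie_bracketE// !dirdM// /nabla.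
have sym := christoffel_mx_sym metric_g ix.
have := sym (L i x *m X x) (L i x *m Y x); have := sym (L i x *m X x) (Y x).
have := sym (L i x *m Y x) (X x); have := sym (X x) (Y x).
move: (christoffel_mx _ _ _) => G.
have AA (w : 'cV_m) : L i x *m (L i x *m w) = - w.
  by rewrite mulmxA LL mulNmx mul1mx.
move: (L i x) AA (X x) (Y x) => A AA u v e1 e2 e3 e4.
rewrite !(mulmxBl, mulmxDl, mulmxBr, mulmxDr, mulNmx, mulmxN) -!mulmxA !AA e1 e2 e3 e4.
by matrix_module.
Qed.

(** Covariant derivative of the relation [L N + N L = a]. *)
Lemma nabla_anticommutes L N a v :
  pderivable (L i) x -> pderivable (N i) x ->
  (forall y, chart_img i y -> L i y *m N i y + N i y *m L i y = a%:M) ->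
  nabla L v *m N i x + L i x *m nabla N v +
    (nabla N v *m L i x + N i x *m nabla L v) = 0.
Proof.
move=> dL dN LN; rewrite -!nablaM// -nablaD; try exact: pderivableM.
rewrite -(nabla_scalar g i x a v); apply: nabla_eq.
exact: (chart_img_near ix).
Qed.

(** Covariant derivative of the relation [L ^ 2 = - 1]. *)
Lemma nabla_anticommutes_self L v : hermitian_structure g L ->
  nabla L v *m L i x + L i x *m nabla L v = 0.
Proof.
move=> herm; have [dL _ _] := herm i x ix.
rewrite -nablaM// -(nabla_scalar g i x (-1) v); apply: nabla_eq.
apply: (chart_img_near ix) => y /herm[_ -> _].
by rewrite raddfN.
Qed.

(** Covariant derivative of the relation [L^T g + g L = 0], as [g] is
    parallel. *)
Lemma nabla_skew L v : hermitian_structure g L ->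
  (nabla L v)^T *m g i x = - (g i x *m nabla L v).
Proof.
move=> herm; have [dL _ Lg] := herm i x ix.
have dg := metric_pderivable metric_g ix; have dLt := pderivable_tr dL.
have := dird_cst x (0 : 'M[R]_m) v.
rewrite -(@near_eq_dird _ _ _ _ (fun y => (L i y)^T *m g i y + g i y *m L i y)); last first.
  by apply: (chart_img_near ix) => y /herm[_ _ ->]; rewrite addNr.
rewrite (dirdD _ (pderivableM dLt dg) (pderivableM dg dL)).
rewrite (dirdM _ dLt dg) (dirdM _ dg dL) dird_tr// (metric_parallel metric_g ix) /nabla.
move: (dird _ _ _) (christoffel_mx _ _ _ _) (g i x) (L i x) Lg => D G h A Ah.
have -> : (D + G *m A - A *m G)^T = D^T + A^T *m G^T - G^T *m A^T.
  by rewrite linearB linearD/= !trmx_mul.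
have GAh : G^T *m A^T *m h = - (G^T *m h *m A) by rewrite -mulmxA Ah mulmxN mulmxA.
rewrite !(mulmxBl, mulmxDl, mulmxBr, mulmxDr) GAh !mulmxA Ah mulNmx => E.
by apply/eqP; rewrite -subr_eq0 -E; apply/eqP; matrix_module.
Qed.

(** Put [B v = nabla_(L v) L - L (nabla_v L)]. The hypothesis makes [B u v]
    symmetric in [u] and [v], while [B u] is skew-adjoint because [L] and [nabla L]
    are skew-adjoint and anticommute. *)
Lemma nijenhuis0_cauchy_riemann L : hermitian_structure g L ->
  (forall u v : 'cV_m,
     (nabla L (L i x *m u) - L i x *m nabla L u) *m v
     - (nabla L (L i x *m v) - L i x *m nabla L v) *m u = 0) ->
  cauchy_riemann g L i x.
Proof.
move=> herm N0 v; have [dL LL Lg] := herm i x ix.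
apply/eqP; rewrite -subr_eq0; apply/eqP; move: v.
apply: (symmetric_skew_eq0 (metric_unit metric_g ix) (riemannian_sym metric_g ix)).
  by move=> u v; apply/eqP; rewrite -subr_eq0 N0.
move=> v; rewrite [(_ - _)^T]linearB/= trmx_mul mulmxBl mulmxBr -mulmxA Lg.
rewrite mulmxN mulmxA !nabla_skew// mulNmx opprK -mulmxA.
have /eqP := nabla_anticommutes_self v herm; rewrite addr_eq0 => /eqP->.
by rewrite mulmxN mulmxA; matrix_module.
Qed.

End AtAPoint.

(** Constant vector fields in a chart already detect all values of the
    Nijenhuis tensor. *)
Lemma integrable_cauchy_riemann g L : riemannian_metric g -> hermitian_structure g L ->
  Defs.integrable L <-> forall i x, chart_img i x -> cauchy_riemann g L i x.
Proof.
move=> metric_g herm; split=> [intL i x ix | CR i X Y sX sY x ix].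
  apply: nijenhuis0_cauchy_riemann => // u v.
  rewrite -(@nijenhuis_nabla _ _ _ metric_g ix L (cst u) (cst v))//;
    try exact: pderivable_cst.
  by apply: intL => //; exact: smooth_cst.
rewrite (nijenhuis_nabla metric_g ix herm); [|exact: smooth_pderivable ix..].
by rewrite !CR// !subrr !mul0mx subrr.
Qed.

End HermitianStructures.

(** * Quaternionic algebra at a point *)

Section QuaternionAlgebra.
Variables (R : realType) (m : nat).
Variables (I J K : 'M[R]_m).
Hypotheses (II : I *m I = - 1%:M) (JJ : J *m J = - 1%:M).
Hypotheses (IJ : I *m J = K) (JI : J *m I = - K).

Definition anticommutator (A B : 'M[R]_m) : 'M[R]_m := A *m B + B *m A.

Lemma mulIK : I *m K = - J.
Proof. by rewrite -IJ mulmxA II mulNmx mul1mx. Qed.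

Lemma mulJK : J *m K = I.
Proof. by rewrite -[K]opprK -JI mulmxN mulmxA JJ mulNmx mul1mx opprK. Qed.

Lemma mulKJ : K *m J = - I.
Proof. by rewrite -IJ -mulmxA JJ mulmxN mulmx1. Qed.

Lemma mulKK : K *m K = - 1%:M.
Proof. by rewrite -{1}IJ -mulmxA mulJK II. Qed.

(** The values of [P] anticommute with [I], so they are determined by their
    anticommutators with [J] and [K]. In terms of these two, the equations
    [P (I v) = I (P v)] become [{J, P (I v)} = - {K, P v}] and
    [{K, P (I v)} = {J, P v}], and each of them implies the other on replacing
    [v] by [I v]. *)
Lemma anticommutator_cauchy_riemann (P : {linear 'cV[R]_m -> 'M[R]_m}) :
  (forall v, P v *m I = - (I *m P v)) ->
  (forall v, P (I *m v) = I *m P v) <->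
  (forall v, anticommutator J (P (I *m v)) = - anticommutator K (P v)).
Proof.
move=> PI; split=> CR v.
  rewrite /anticommutator CR mulmxA JI -(opprK (I *m P v)) -PI !mulNmx -mulmxA IJ.
  by matrix_module.
(* The terms [K p K] and [J p J] cancel when [p] anticommutes with [I]. *)
have recover p : p *m I = - (I *m p) ->
    p *+ 2 = - (anticommutator K p *m K + anticommutator J p *m J).
  move=> pI; rewrite /anticommutator !mulmxDl -(mulmxA p K) mulKK -(mulmxA p J) JJ.
  have -> : K *m p *m K = - (J *m p *m J).
    transitivity (- (J *m I) *m p *m (I *m J)); first by rewrite JI opprK IJ.
    have JII q : J *m I *m (I *m q) = - (J *m q).
      by rewrite mulmxA -(mulmxA J) II mulmxN mulmx1 mulNmx.
    by rewrite mulmxA -(mulmxA _ p I) pI !(mulmxN, mulNmx) opprK JII mulNmx.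
  by rewrite !mulmxN mulmx1; matrix_module.
have PIvI : P (I *m v) *m I = - (I *m P (I *m v)) by exact: PI.
have E := recover _ PIvI; move: E.
have CR' : anticommutator K (P (I *m v)) = anticommutator J (P v).
  have := CR (I *m v); rewrite mulmxA II mulNmx mul1mx linearN.
  rewrite /anticommutator mulmxN mulNmx -opprD => /oppr_inj E; exact/esym.
rewrite CR CR' mulNmx /anticommutator !mulmxDl -!mulmxA.
have -> : J *m (P v *m K) = K *m (P v *m J).
  rewrite -[in LHS]IJ (mulmxA (P v)) PI mulNmx mulmxN -(mulmxA I).
  by rewrite (mulmxA J I) JI mulNmx opprK.
rewrite mulJK mulKJ mulmxN PI => E.
apply: (scalerI (_ : 2%:R != 0 :> R)); first by rewrite pnatr_eq0.
by rewrite !scaler_nat E; matrix_module.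
Qed.

End QuaternionAlgebra.

(** * Adapted frames of the hypercomplex structure *)

Definition comb (R : realType) (m : nat) (M : smoothManifold R m) (a b : R)
  (U V : tensor2 M) : tensor2 M := fun i x => a *: U i x + b *: V i x.

(** Equations between linear combinations of tensors are checked entrywise. *)
Ltac tensor_module :=
  apply/funext => ?; apply/funext => ?; rewrite /lincomb3 /comb /oppT;
  apply/matrixP => ? ?; rewrite !mxE; ring.

Section Frames.
Variables (R : realType) (m : nat) (M : smoothManifold R m).
Implicit Types (U V L I J K : tensor2 M).

Definition unit_sphere I J K : set (tensor2 M) :=
  [set L | exists a b c : R,
     a ^+ 2 + b ^+ 2 + c ^+ 2 = 1 /\ L = lincomb3 a b c I J K].

Variables (H : set (tensor2 M)) (g : tensor2 M).

(** A hyperhermitian basis of [H]: a triple whose unit sphere is [H]. Only the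
    regularity and the identities that differentiation needs are kept, so that
    frames can be rotated freely. *)
Record frame I J K : Prop := Frame {
  frame_hermitian1 : hermitian_structure g I;
  frame_hermitian2 : hermitian_structure g J;
  frame_hermitian3 : hermitian_structure g K;
  frame_mul12 : forall i x, chart_img i x -> I i x *m J i x = K i x;
  frame_mul21 : forall i x, chart_img i x -> J i x *m I i x = - K i x;
  frame_sphere : H = unit_sphere I J K }.

Lemma frame_exists : almost_hyperhermitian H g -> exists I J K, frame I J K.
Proof.
move=> [[I [J [K [acI acJ acK IJK HE]]]] metric_g herm].
have hermitian L : almost_complex L -> H L -> hermitian_structure g L.
  move=> [[sL _ _] LL] HL i x ix; split; [exact: smooth_pderivable ix | exact: LL |].
  have LgL : (L i x)^T *m g i x *m L i x = g i x.
    apply: bilin_inj => X Y; rewrite -(herm L HL i x ix X Y).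
    by rewrite /bilin trmx_mul !mulmxA.
  by rewrite -[in RHS]LgL -mulmxA LL// mulmxN mulmx1 opprK.
exists I, J, K; split=> //; try (apply: hermitian => //; rewrite HE).
- by exists 1, 0, 0; split; [ring | tensor_module].
- by exists 0, 1, 0; split; [ring | tensor_module].
- by exists 0, 0, 1; split; [ring | tensor_module].
- by move=> i x /IJK[].
- by move=> i x /IJK[_ <-]; rewrite opprK.
Qed.

Lemma lincomb3_comb a b c I J K :
  lincomb3 a b c I J K = comb a 1 I (comb b c J K).
Proof.
by apply/funext => i; apply/funext => x; rewrite /lincomb3 /comb scale1r addrA.
Qed.

Lemma frame_cyc I J K : frame I J K -> frame J K I.
Proof.
case=> hI hJ hK IJ JI HE; split=> //.
- move=> i x ix; have [_ JJ _] := hJ i x ix.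
  exact: (mulJK JJ (JI i x ix)).
- move=> i x ix; have [_ JJ _] := hJ i x ix.
  exact: (mulKJ JJ (IJ i x ix)).
- rewrite HE; apply/seteqP; split=> L /= [a [b [c [n1 ->]]]].
    exists b, c, a; split; first by rewrite -n1; ring.
    by tensor_module.
  exists c, a, b; split; first by rewrite -n1; ring.
  by tensor_module.
Qed.

Lemma comb_hermitian a b I J : a ^+ 2 + b ^+ 2 = 1 ->
  hermitian_structure g I -> hermitian_structure g J ->
  (forall i x, chart_img i x -> anticommutator (I i x) (J i x) = 0) ->
  hermitian_structure g (comb a b I J).
Proof.
move=> ab1 hI hJ IJ i x ix.
have [dI II Ig] := hI i x ix; have [dJ JJ Jg] := hJ i x ix.
split; first by apply: pderivableD; exact: pderivableZ.
  have := IJ i x ix; rewrite /anticommutator => /eqP; rewrite addr_eq0 => /eqP IJi.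
  rewrite /comb !(mulmxDl, mulmxDr) -!scalemxAl -!scalemxAr II JJ IJi.
  by rewrite -[RHS]scale1r; move: 1%:M => N; rewrite -ab1; matrix_module.
rewrite /comb linearD/= !linearZ/= mulmxDl mulmxDr -!scalemxAl -!scalemxAr Ig Jg.
by matrix_module.
Qed.

Lemma frame_anticommute I J K i x : frame I J K -> chart_img i x ->
  anticommutator (I i x) (J i x) = 0.
Proof.
by move=> fr ix; rewrite /anticommutator (frame_mul12 fr ix) (frame_mul21 fr ix) subrr.
Qed.

Lemma frame_rotate a b I J K : a ^+ 2 + b ^+ 2 = 1 -> frame I J K ->
  frame (comb a b I J) (comb (- b) a I J) K.
Proof.
move=> ab1 fr; have [hI hJ hK IJ JI HE] := fr.
have anti i x : chart_img i x -> anticommutator (I i x) (J i x) = 0.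
  by move=> ix; exact: frame_anticommute fr ix.
split=> //.
- exact: comb_hermitian.
- by apply: comb_hermitian => //; rewrite sqrrN addrC.
- move=> i x ix; have [_ II _] := hI i x ix; have [_ JJ _] := hJ i x ix.
  rewrite /comb !(mulmxDl, mulmxDr) -!scalemxAl -!scalemxAr II JJ IJ// JI//.
  by rewrite -[RHS]scale1r; move: 1%:M => N; rewrite -ab1; matrix_module.
- move=> i x ix; have [_ II _] := hI i x ix; have [_ JJ _] := hJ i x ix.
  rewrite /comb !(mulmxDl, mulmxDr) -!scalemxAl -!scalemxAr II JJ IJ// JI//.
  by rewrite -[RHS]scale1r; move: 1%:M => N; rewrite -ab1; matrix_module.
- rewrite HE; apply/seteqP; split=> L /= [x [y [z [n1 ->]]]].
    exists (a * x + b * y), (a * y - b * x), z; split.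
      by rewrite -n1 -[X in _ = X + _]mul1r -ab1; ring.
    rewrite -[lincomb3 x _ _ _ _ _](_ : lincomb3 ((a ^+ 2 + b ^+ 2) * x)
      ((a ^+ 2 + b ^+ 2) * y) z I J K = _); last by rewrite ab1 !mul1r.
    by tensor_module.
  exists (a * x - b * y), (a * y + b * x), z; split.
    by rewrite -n1 -[X in _ = X + _]mul1r -ab1; ring.
  by tensor_module.
Qed.

(** Polar coordinates with an arbitrary angle, here [0], when [t = 0]. *)
Lemma polar (b c : R) : exists t p q,
  [/\ t ^+ 2 = b ^+ 2 + c ^+ 2, p ^+ 2 + q ^+ 2 = 1, b = t * p & c = t * q].
Proof.
have bc0 : 0 <= b ^+ 2 + c ^+ 2 by rewrite addr_ge0 ?sqr_ge0.
pose t := Num.sqrt (b ^+ 2 + c ^+ 2).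
have tE : t ^+ 2 = b ^+ 2 + c ^+ 2 by rewrite sqr_sqrtr.
have [t0|t0] := eqVneq t 0.
  move/eqP: (esym tE); rewrite t0 expr0n/= paddr_eq0 ?sqr_ge0// !sqrf_eq0.
  move=> /andP[/eqP b0 /eqP c0].
  by exists 0, 1, 0; rewrite b0 c0 expr1n expr0n/= !addr0 !mul0r.
exists t, (b / t), (c / t); split=> //; last 2 first.
- by rewrite mulrC divfK.
- by rewrite mulrC divfK.
by rewrite !expr_div_n -mulrDl -tE divff// sqrf_eq0.
Qed.

(** A rotation of the plane of [J] and [K] brings any element of [H] into the
    plane of [I] and the new second vector. *)
Lemma frame_align I J K a b c : frame I J K -> a ^+ 2 + b ^+ 2 + c ^+ 2 = 1 ->
  exists s t p q, [/\ s ^+ 2 + t ^+ 2 = 1, p ^+ 2 + q ^+ 2 = 1,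
    frame I (comb p q J K) (comb (- q) p J K)
    & lincomb3 a b c I J K = comb s t I (comb p q J K)].
Proof.
move=> fr n1.
have [t [p [q [tE pq1 -> ->]]]] := polar b c.
exists a, t, p, q; split=> //; first by rewrite tE addrA.
  exact/frame_cyc/frame_cyc/frame_rotate/frame_cyc.
by tensor_module.
Qed.

Lemma frame_coordinates I J K L : frame I J K -> H L -> exists a b c,
  a ^+ 2 + b ^+ 2 + c ^+ 2 = 1 /\ L = lincomb3 a b c I J K.
Proof. by move=> fr; rewrite (frame_sphere fr). Qed.

(** Align the frame with [L] by a rotation about [I], then rotate the plane of
    the first two vectors so that the first becomes [L]. *)
Lemma frame_through L I J K : frame I J K -> H L -> exists V W, frame L V W.
Proof.
move=> fr; rewrite (frame_sphere fr) => -[a [b [c [n1 ->]]]].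
have [s [t [p [q [st1 _ fr' ->]]]]] := frame_align fr n1.
by do 2!eexists; exact: frame_rotate fr'.
Qed.

Lemma frame_mem1 I J K : frame I J K -> H I.
Proof.
move=> fr; rewrite (frame_sphere fr); exists 1, 0, 0; split; first by ring.
by tensor_module.
Qed.

End Frames.

(** * Integrable and semi-Kaehler elements of a frame *)

Section Hyperhermitian.
Variables (R : realType) (m : nat) (M : smoothManifold R m).
Implicit Types (U V L I J K : tensor2 M).
Variables (H : set (tensor2 M)) (g : tensor2 M).
Hypothesis metric_g : riemannian_metric g.
Local Notation frame := (frame H g).

Section Mixed.
Variables (i : chart_index M) (x : 'cV[R]_m).
Hypothesis ix : chart_img i x.

(** The curly bracket [{U, V}] of the proof outline, in the direction [v]. *)
Definition mixed U V (v : 'cV[R]_m) := anticommutator (U i x) (nabla g i x V v).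

(** Covariant derivative of the relation [U V + V U = 0]. *)
Lemma mixed_antisym U V v : pderivable (U i) x -> pderivable (V i) x ->
  (forall y, chart_img i y -> anticommutator (U i y) (V i y) = 0) ->
  mixed U V v = - mixed V U v.
Proof.
move=> dU dV UV; apply/eqP; rewrite -subr_eq0 opprK; apply/eqP.
rewrite -[RHS](@nabla_anticommutes _ _ _ g _ _ ix U V 0 v)//; last first.
  by move=> y iy; rewrite raddf0; exact: UV.
by rewrite /mixed /anticommutator; matrix_module.
Qed.

Lemma mixed_self U v : hermitian_structure g U -> mixed U U v = 0.
Proof.
by move=> herm; rewrite /mixed /anticommutator addrC (nabla_anticommutes_self ix).
Qed.

Lemma mixed_combl a b U V L v :
  mixed (comb a b U V) L v = a *: mixed U L v + b *: mixed V L v.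
Proof.
rewrite /mixed /anticommutator /comb; move: (nabla _ _ _ _ _) => N.
rewrite mulmxDl mulmxDr -!scalemxAl -!scalemxAr.
by matrix_module.
Qed.

Lemma nabla_comb a b U V v : pderivable (U i) x -> pderivable (V i) x ->
  nabla g i x (comb a b U V) v = a *: nabla g i x U v + b *: nabla g i x V v.
Proof.
move=> dU dV; rewrite -(nablaZ g dU a) -(nablaZ g dV b).
apply: (nablaD g (L := fun j y => a *: U j y) (N := fun j y => b *: V j y)).
  exact: pderivableZ.
exact: pderivableZ.
Qed.

Lemma mixed_combr a b U V L v : pderivable (U i) x -> pderivable (V i) x ->
  mixed L (comb a b U V) v = a *: mixed L U v + b *: mixed L V v.
Proof.
move=> dU dV; rewrite /mixed /anticommutator nabla_comb//.
move: (nabla _ _ _ U _) (nabla _ _ _ V _) => P Q.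
rewrite mulmxDl mulmxDr -!scalemxAl -!scalemxAr.
by matrix_module.
Qed.

Lemma mixed_is_linear U V : linear (mixed U V).
Proof.
move=> a u v; rewrite /mixed /anticommutator linearP/=.
move: (nabla _ _ _ _ u) (nabla _ _ _ _ v) => P Q.
rewrite mulmxDl mulmxDr -!scalemxAl -!scalemxAr.
by matrix_module.
Qed.

HB.instance Definition _ U V :=
  GRing.isLinear.Build R 'cV[R]_m 'M[R]_m _ (mixed U V) (mixed_is_linear U V).

Lemma mixed_cauchy_riemann I J K : frame I J K ->
  cauchy_riemann g I i x <-> forall v, mixed J I (I i x *m v) = - mixed K I v.
Proof.
move=> fr; have [_ II _] := frame_hermitian1 fr ix.
have [_ JJ _] := frame_hermitian2 fr ix.
apply: (anticommutator_cauchy_riemann II JJ (frame_mul12 fr ix) (frame_mul21 fr ix)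
  (P := nabla g i x I)) => v.
apply/eqP; rewrite -addr_eq0; apply/eqP.
apply (nabla_anticommutes_self ix v (frame_hermitian1 fr)).
Qed.

Lemma frame_pderivable I J K : frame I J K ->
  [/\ pderivable (I i) x, pderivable (J i) x & pderivable (K i) x].
Proof.
by move=> [hI hJ hK _ _ _]; have [? _ _] := hI i x ix; have [? _ _] := hJ i x ix;
  have [? _ _] := hK i x ix.
Qed.

Lemma frame_mixed_antisym I J K v : frame I J K ->
  mixed I J v = - mixed J I v.
Proof.
move=> fr; have [dI dJ _] := frame_pderivable fr.
by apply: mixed_antisym => // y iy; exact: frame_anticommute fr iy.
Qed.

(** The equation of the frame [(J, K, I)], rewritten on the form
    [mixed J I] that also occurs in the equation for [I]. *)
Lemma mixed_cauchy_riemann2 I J K : frame I J K ->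
  cauchy_riemann g J i x <-> forall v, mixed J I (J i x *m v) = - mixed K J v.
Proof.
move=> fr; have fr2 := frame_cyc fr; have [_ JJ _] := frame_hermitian2 fr ix.
rewrite (mixed_cauchy_riemann fr2); split=> E v.
  have := E (J i x *m v); rewrite mulmxA JJ mulNmx mul1mx linearN/= => /oppr_inj ->.
  by rewrite (frame_mixed_antisym _ fr) opprK.
rewrite (frame_mixed_antisym _ fr) opprK.
by rewrite -[v in RHS]opprK -[v in RHS]mul1mx -mulNmx -JJ linearN/= -mulmxA E opprK.
Qed.

(** Integrability of [a I + b J] is expressed in the frame
    [(a I + b J, - b I + a J, K)]. Rotating [I] and [J] in their plane does not
    change [mixed J I], so the condition is the combination with coefficients
    [a] and [b] of those for [I] and [J]. *)
Lemma mixed_cauchy_riemann_rotate I J K a b : frame I J K -> a ^+ 2 + b ^+ 2 = 1 ->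
  cauchy_riemann g (comb a b I J) i x <->
  forall v, a *: mixed J I (I i x *m v) + b *: mixed J I (J i x *m v) =
    - (a *: mixed K I v + b *: mixed K J v).
Proof.
move=> fr ab1; have [dI dJ _] := frame_pderivable fr.
rewrite (mixed_cauchy_riemann (frame_rotate ab1 fr)).
have JI v : mixed (comb (- b) a I J) (comb a b I J) v = mixed J I v.
  rewrite mixed_combl (mixed_combr a b I v dI dJ) (mixed_combr a b J v dI dJ).
  rewrite (mixed_self v (frame_hermitian1 fr)) (mixed_self v (frame_hermitian2 fr)).
  rewrite (frame_mixed_antisym _ fr) -[RHS]scale1r; move: (mixed J I v) => N.
  by rewrite -ab1; matrix_module.
have E v : a *: mixed J I (I i x *m v) + b *: mixed J I (J i x *m v) =
    mixed J I (comb a b I J i x *m v).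
  by rewrite /comb mulmxDl -!scalemxAl linearP linearZ.
by split=> + v => /(_ v); rewrite JI E (mixed_combr _ _ _ _ dI dJ).
Qed.

End Mixed.

Local Notation integrable := (@Defs.integrable R m M).

Lemma frame_integrable I J K : frame I J K -> integrable I <->
  forall i x, chart_img i x -> cauchy_riemann g I i x.
Proof. by move=> fr; exact: integrable_cauchy_riemann metric_g (frame_hermitian1 fr). Qed.

Lemma integrable_rotate I J K a b : frame I J K -> a ^+ 2 + b ^+ 2 = 1 ->
  integrable I -> integrable J -> integrable (comb a b I J).
Proof.
move=> fr ab1 /(frame_integrable fr) CI /(frame_integrable (frame_cyc fr)) CJ.
apply/(frame_integrable (frame_rotate ab1 fr)) => i x ix.
apply/(mixed_cauchy_riemann_rotate ix fr ab1) => v.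
rewrite ((mixed_cauchy_riemann ix fr).1 (CI i x ix)).
rewrite ((mixed_cauchy_riemann2 ix fr).1 (CJ i x ix)).
by rewrite !scalerN opprD.
Qed.

Lemma integrable_second I J K a b : frame I J K -> a ^+ 2 + b ^+ 2 = 1 -> b != 0 ->
  integrable I -> integrable (comb a b I J) -> integrable J.
Proof.
move=> fr ab1 b0 /(frame_integrable fr) CI /(frame_integrable (frame_rotate ab1 fr)) CL.
apply/(frame_integrable (frame_cyc fr)) => i x ix.
apply/(mixed_cauchy_riemann2 ix fr) => v.
have := (mixed_cauchy_riemann_rotate ix fr ab1).1 (CL i x ix) v.
rewrite ((mixed_cauchy_riemann ix fr).1 (CI i x ix)) scalerN opprD => /addrI.
by rewrite -scalerN => /(scalerI b0).
Qed.

(** From [{J, I} (I w) = - {K, I} w] at [w = K v], where [I K = - J], and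
    from the equation for [J] at [v]. *)
Lemma integrable_third I J K : frame I J K ->
  integrable I -> integrable J -> integrable K.
Proof.
move=> fr /(frame_integrable fr) CI /(frame_integrable (frame_cyc fr)) CJ.
have fr3 := frame_cyc (frame_cyc fr).
apply/(frame_integrable fr3) => i x ix.
apply/(mixed_cauchy_riemann ix fr3) => v.
have CRI := (mixed_cauchy_riemann ix fr).1 (CI i x ix).
have CRJ := (mixed_cauchy_riemann2 ix fr).1 (CJ i x ix).
have [_ II _] := frame_hermitian1 fr ix.
rewrite -[LHS]opprK -(frame_mixed_antisym ix _ fr3) -CRI mulmxA.
rewrite (mulIK II (frame_mul12 fr ix)) mulNmx linearN/= CRJ opprK.
by rewrite (frame_mixed_antisym ix _ (frame_cyc fr)) opprK.
Qed.

(** [J] and [K] are integrable, hence so are the unit vectors [J'] of their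
    plane, and every element of [H] lies in the plane of [I] and such a [J']. *)
Lemma integrable_all I J K a b : frame I J K -> a ^+ 2 + b ^+ 2 = 1 -> b != 0 ->
  integrable I -> integrable (comb a b I J) -> forall L, H L -> integrable L.
Proof.
move=> fr ab1 b0 intI intL L.
have intJ := integrable_second fr ab1 b0 intI intL.
have intK := integrable_third fr intI intJ.
rewrite (frame_sphere fr) => -[x [y [z [n1 ->]]]].
have [s [t [p [q [st1 pq1 fr' ->]]]]] := frame_align fr n1.
apply: (integrable_rotate fr') => //.
exact: (integrable_rotate (frame_cyc fr)).
Qed.

Definition differentiable_tensor L :=
  forall i x, chart_img i x -> pderivable (L i) x.

Lemma frame_differentiable I J K : frame I J K ->
  [/\ differentiable_tensor I, differentiable_tensor J & differentiable_tensor K].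
Proof. by move=> fr; split=> i x ix; have [] := frame_pderivable ix fr. Qed.

Lemma differentiable_comb a b U V : differentiable_tensor U ->
  differentiable_tensor V -> differentiable_tensor (comb a b U V).
Proof.
move=> dU dV i x ix.
by apply: pderivableD; apply: pderivableZ; [exact: dU | exact: dV].
Qed.

(** The metric is invertible, so the codifferential vanishes with its dual
    vector. *)
Lemma semi_kahlerP L : differentiable_tensor L -> semi_kahler g L <->
  forall i x, chart_img i x -> metric_trace (nabla g i x L) (invmx (g i x)) = 0.
Proof.
move=> dL; split=> sk i x ix; last first.
  move=> b.
  by rewrite (codiff_fundamental_form metric_g ix b (dL i x ix)) sk// trmx0 mul0mx mxE oppr0.
have gU := metric_unit metric_g ix.
apply: trmx_inj; rewrite trmx0 -[LHS](mulmxK gU); apply/eqP.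
rewrite [X in X *m _](_ : _ = 0) ?mul0mx//; apply/matrixP => k b.
have := sk i x ix b; rewrite (codiff_fundamental_form metric_g ix b (dL i x ix)) ord1.
by move/eqP; rewrite oppr_eq0 => /eqP ->; rewrite mxE.
Qed.

Lemma semi_kahler_comb a b U V : differentiable_tensor U -> differentiable_tensor V ->
  semi_kahler g U -> semi_kahler g V -> semi_kahler g (comb a b U V).
Proof.
move=> dU dV /(semi_kahlerP dU) skU /(semi_kahlerP dV) skV.
apply/(semi_kahlerP (differentiable_comb dU dV)) => i x ix.
rewrite (eq_metric_trace _ (fun v => nabla_comb a b v (dU i x ix) (dV i x ix))).
rewrite metric_traceD !metric_traceZ.
by rewrite skU// skV// !scaler0 addr0.
Qed.

(** With [G] the inverse metric, [nabla K = (nabla I) J + I (nabla J)] leaves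
    the trace [t] of [(nabla I) J], that is [metric_trace (nabla I) (J G)]. On the
    one hand [I t] is the trace with the direction [v] replaced by [I v], as [I] is
    integrable; on the other hand this replacement multiplies [J G] by [I^T] on
    the right, where [G I^T = - I G], and since [J] and [nabla I] anticommute with
    [I], the result is [- I t]. *)
Lemma semi_kahler_mul I J K : frame I J K ->
  integrable I -> semi_kahler g J -> semi_kahler g K.
Proof.
move=> fr /(frame_integrable fr) CI.
have [_ diffJ diffK] := frame_differentiable fr.
move=> /(semi_kahlerP diffJ) skJ; apply/(semi_kahlerP diffK) => i x ix.
have [dI dJ _] := frame_pderivable ix fr.
have [_ II Ig] := frame_hermitian1 fr ix.
set G := invmx (g i x); pose P := nabla g i x I.
have PK : nabla g i x K =1
    fun v => P v *m J i x + I i x *m nabla g i x J v.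
  move=> v; rewrite -(nablaM g dI dJ); apply: nabla_eq.
  by apply: (chart_img_near ix) => y iy; rewrite (frame_mul12 fr iy).
rewrite (eq_metric_trace _ PK) metric_traceD metric_trace_mull skJ// mulmx0 addr0.
rewrite metric_trace_mulr.
set t := metric_trace _ _.
have tN : I i x *m t = - (I i x *m t).
  have gU := metric_unit metric_g ix.
  have GI : G *m (I i x)^T = - (I i x *m G).
    apply: (can_inj (mulKmx gU)); apply: (can_inj (mulmxK gU)).
    rewrite mulmxA mulmxV// mul1mx Ig mulmxN mulNmx.
    by rewrite mulmxA -[in RHS]mulmxA mulVmx// mulmx1.
  transitivity (metric_trace (fun v => nabla g i x I (I i x *m v)) (J i x *m G)).
    by rewrite (eq_metric_trace _ (CI i x ix)) metric_trace_mull.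
  rewrite (metric_trace_comp (nabla g i x I)) -mulmxA GI mulmxN mulmxA (frame_mul21 fr ix).
  rewrite -(frame_mul12 fr ix) mulNmx opprK -mulmxA -[LHS]metric_trace_mulr.
  have PI : (fun v => nabla g i x I v *m I i x) =1 fun v => - (I i x) *m P v.
    move=> v; apply/eqP; rewrite mulNmx -addr_eq0; apply/eqP.
    apply (nabla_anticommutes_self ix v (frame_hermitian1 fr)).
  by rewrite (eq_metric_trace _ PI) metric_trace_mull mulNmx.
have It0 : I i x *m t = 0.
  apply/eqP; have /eqP := tN; rewrite -addr_eq0 -mulr2n -scaler_nat scaler_eq0.
  by rewrite pnatr_eq0.
by rewrite -[t]opprK -[t]mul1mx -mulNmx -II -mulmxA It0 mulmx0 oppr0.
Qed.

End Hyperhermitian.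

(** * Classification *)

Section Orthogonality.
Variables (R : realType) (m : nat) (M : smoothManifold R m).
Implicit Types (U V L I J K : tensor2 M).
Variables (H : set (tensor2 M)) (g : tensor2 M).
Hypotheses (m_gt0 : (0 < m)%N) (M_nonempty : [set: M] !=set0).
Local Notation frame := (frame H g).
Local Notation orthogonal := (@Defs.orthogonal R m M).

Lemma chart_point : exists i x, @chart_img R m M i x.
Proof.
have [p _] := M_nonempty; have [i ip] := chart_cover p.
by exists i, (chart_map i p), p.
Qed.

Lemma mxtrace_frame I J K i x : frame I J K -> chart_img i x -> \tr (K i x) = 0.
Proof.
move=> fr ix; have : \tr (K i x) = - \tr (K i x).
  rewrite -{1}(frame_mul12 fr ix) mxtrace_mulC (frame_mul21 fr ix).
  exact: raddfN.
by lra.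
Qed.

(** The products [J I] and [K I] of anticommuting matrices have trace zero,
    while [I ^ 2] has trace [- m]. *)
Lemma orthogonal_lincomb3 I J K a b c : frame I J K ->
  orthogonal (lincomb3 a b c I J K) I <-> a = 0.
Proof.
move=> fr; have fr2 := frame_cyc fr; have fr3 := frame_cyc fr2.
have E i x : chart_img i x ->
    \tr (lincomb3 a b c I J K i x *m I i x) = - (a * m%:R).
  move=> ix; have [_ II _] := frame_hermitian1 fr ix.
  rewrite /lincomb3 !mulmxDl -!scalemxAl II (frame_mul21 fr ix) (frame_mul12 fr3 ix).
  rewrite !mxtraceD !mxtraceZ !raddfN/= (mxtrace_frame fr ix) (mxtrace_frame fr3 ix).
  by rewrite mxtrace1; ring.
split=> [orth | a0 i x ix]; last by rewrite E// a0 mul0r oppr0.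
have [i [x ix]] := chart_point; have /eqP := orth i x ix.
by rewrite E// oppr_eq0 mulf_eq0 pnatr_eq0 (gtn_eqF m_gt0) orbF => /eqP.
Qed.

Lemma orthogonal_self_absurd I J K : frame I J K -> ~ orthogonal I I.
Proof.
move=> fr; have /(_ I J K 1 0 0 fr)[+ _] := orthogonal_lincomb3.
rewrite (_ : lincomb3 1 0 0 I J K = I); last by tensor_module.
by move=> E /E /eqP; rewrite oner_eq0.
Qed.

Lemma orthogonal_oppl U V : orthogonal (oppT U) V <-> orthogonal U V.
Proof.
have trN i x : \tr (oppT U i x *m V i x) = - \tr (U i x *m V i x).
  by rewrite /oppT mulNmx raddfN.
by split=> E i x ix; apply/eqP; have /eqP := E i x ix; rewrite trN oppr_eq0.
Qed.

Lemma orthogonal_sym U V : orthogonal U V -> orthogonal V U.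
Proof. by move=> E i x ix; rewrite mxtrace_mulC; exact: E. Qed.

(** [H] contains an element orthogonal to [L], which cannot be [L] or its
    opposite. *)
Lemma not_all_unique I J K (P : tensor2 M -> Prop) L : frame I J K ->
  unique_up_to_sign H P L -> ~ (forall L', H L' -> P L').
Proof.
move=> fr [HL _ uL] allP; have [V [W fr']] := frame_through fr HL.
have fr2 := frame_cyc fr'; have HV := frame_mem1 fr2.
have VL : orthogonal V L.
  have /(_ L V W 0 1 0 fr')[_] := orthogonal_lincomb3.
  rewrite (_ : lincomb3 0 1 0 L V W = V); last by tensor_module.
  exact.
have /orthogonal_self_absurd := fr'; apply.
by have [VE|VE] := uL V HV (allP V HV); [rewrite -{1}VE | apply/orthogonal_oppl; rewrite -VE].
Qed.

(** Types 1, 2 and 4 differ by whether the integrable and the semi-Kaehler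
    structures are all of [H] or unique up to sign. Type 3 excludes type 1 by the
    uniqueness of the integrable structure, type 2, as that structure is not
    orthogonal to itself, and type 4, whose semi-Kaehler structure is not
    orthogonal to the integrable one. *)
Lemma of_type_inj I J K t u : frame I J K -> of_type H g t -> of_type H g u -> t = u.
Proof.
move=> fr; have absurd := not_all_unique fr.
pose rank t := match t with Type1 => 0 | Type2 => 1 | Type3 => 2 | Type4 => 3 end%N.
wlog : t u / (rank t <= rank u)%N => [W T U|].
  by case/orP: (leq_total (rank t) (rank u)) => le; [exact: W|apply/esym/W].
case: t; case: u => //= _.
- by move=> T [[L /absurd uL] _]; case: uL => V /T[].
- by move=> T [L [/absurd uL _]]; case: uL => V /T[].
- by move=> T [L [_ [/absurd uL _ _]]]; case: uL => V /T[].
- move=> [_ T] [L [[HL _ _] skL]].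
  have [V [W fr']] := frame_through fr HL.
  by case: (orthogonal_self_absurd fr'); apply/(skL L HL); exact: T.
- by move=> [_ T] [_ [L [_ /absurd uL _]]]; case: uL.
- move=> [L [[HL intL uL] skL]] [L' [S [[HL' intL' _] [HS skS _] nSL']]].
  case: nSL'; have SL := (skL S HS).1 skS.
  by have [-> //|->] := uL L' HL' intL'; apply/orthogonal_sym/orthogonal_oppl/orthogonal_sym.
Qed.

End Orthogonality.

Section Classification.
Variables (R : realType) (m : nat) (M : smoothManifold R m).
Implicit Types (U V L I J K : tensor2 M).
Variables (H : set (tensor2 M)) (g : tensor2 M).
Hypotheses (m_gt0 : (0 < m)%N) (M_nonempty : [set: M] !=set0).
Hypothesis metric_g : riemannian_metric g.
Local Notation frame := (frame H g).
Local Notation orthogonal := (@Defs.orthogonal R m M).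
Local Notation integrable := (@Defs.integrable R m M).

Lemma semi_kahler_all I J K : frame I J K -> semi_kahler g I -> semi_kahler g J ->
  semi_kahler g K -> forall L, H L -> semi_kahler g L.
Proof.
move=> fr skI skJ skK L; rewrite (frame_sphere fr) => -[a [b [c [_ ->]]]].
have [dI dJ dK] := frame_differentiable fr.
rewrite lincomb3_comb; apply: (semi_kahler_comb metric_g) => //.
  exact: differentiable_comb.
exact: (semi_kahler_comb metric_g).
Qed.

(** In a frame [(L, V, W)], [semi_kahler_mul] with the integrable factor [W]
    applies to [W L = V], and then, with the integrable factor [L], to [L V = W]. *)
Lemma integrable_all_semi_kahler L : (forall V, H V -> integrable V) ->
  (exists I J K, frame I J K) -> H L -> semi_kahler g L ->
  forall V, H V -> semi_kahler g V.
Proof.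
move=> intH [I [J [K fr0]]] HL skL; have [V [W fr]] := frame_through fr0 HL.
have fr2 := frame_cyc fr; have fr3 := frame_cyc fr2.
have skV : semi_kahler g V.
  by apply: (semi_kahler_mul metric_g fr3) => //; exact/intH/(frame_mem1 fr3).
apply: (semi_kahler_all fr) => //.
by apply: (semi_kahler_mul metric_g fr) => //; exact: intH.
Qed.

(** Otherwise the unit vector along [b J + c K] is semi-Kaehler, and so is its
    product with [I]; these two span [J]. *)
Lemma semi_kahler_orthogonal I J K b c : frame I J K -> integrable I ->
  semi_kahler g (comb b c J K) -> ~ semi_kahler g J -> b = 0 /\ c = 0.
Proof.
move=> fr intI; have [t [p [q [_ pq1 -> ->]]]] := polar b c.
have [->|t0] := eqVneq t 0; first by rewrite !mul0r.
move=> sk []; have fr' := frame_rotate pq1 (frame_cyc fr).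
set V := comb p q J K; set W := comb (- q) p J K.
have [dV dW _] := frame_differentiable fr'.
have skV : semi_kahler g V.
  have -> : V = comb t^-1 0 (comb (t * p) (t * q) J K) (comb (t * p) (t * q) J K).
    transitivity (comb (t^-1 * (t * p)) (t^-1 * (t * q)) J K); first by rewrite !mulKf.
    by tensor_module.
  have [_ dJ dK] := frame_differentiable fr.
  have dX := differentiable_comb (a := t * p) (b := t * q) dJ dK.
  exact: (semi_kahler_comb metric_g _ _ dX dX sk sk).
have -> : J = comb p (- q) V W.
  rewrite -[LHS](_ : comb (p ^+ 2 + q ^+ 2) 0 J K = J); last by rewrite pq1; tensor_module.
  by tensor_module.
apply: (semi_kahler_comb metric_g _ _ dV dW skV).
exact: (semi_kahler_mul metric_g (frame_cyc (frame_cyc fr'))).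
Qed.

(** The frame is chosen so that [I] is integrable and the given semi-Kaehler
    structure is [L = a I + b J]. When [I] is unique up to sign, the type is decided
    by whether [J] and [I] are semi-Kaehler. *)
Lemma of_type_exists : almost_hyperhermitian H g -> semi_integrable H g ->
  exists t, of_type H g t.
Proof.
move=> /frame_exists[I0 [J0 [K0 fr0]]] [I [L [HI HL intI skL]]].
have [J1 [K1 fr1]] := frame_through fr0 HI.
have [x [y [z [n1 LE]]]] := frame_coordinates fr1 HL.
have [a [b [p [q [ab1 _ fr LE']]]]] := frame_align fr1 n1.
move: fr LE'; set J := comb p q J1 K1; set K := comb (- q) p J1 K1 => fr LE'.
have {x y z n1 LE LE'}LE : L = comb a b I J by rewrite LE.
have [[V [HV intV VI VNI]]|uI] :=
    pselect (exists V, [/\ H V, integrable V, V <> I & V <> oppT I]).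
  exists Type1 => /=.
  suff intH V' : H V' -> integrable V'.
    move=> V' HV'; split; first exact: intH.
    have exfr : exists I J K, frame I J K by exists I, J, K.
    exact: (integrable_all_semi_kahler intH exfr HL skL HV').
  have [x [y [z [n1 VE]]]] := frame_coordinates fr HV.
  have [s [t [r [w [st1 _ fr' VE']]]]] := frame_align fr n1.
  have {}VE : V = comb s t I (comb r w J K) by rewrite VE.
  apply: (integrable_all metric_g fr' st1) => //; last by rewrite -VE.
  (* For [t = 0] the structure [V] would be [I] or its opposite. *)
  apply/eqP => t0; move: st1; rewrite t0 expr0n/= addr0 => /eqP.
  rewrite sqrf_eq1 => /orP[] /eqP s1; [case: VI | case: VNI]; rewrite VE s1 t0.
    by tensor_module.
  by tensor_module.
have {}uI : unique_up_to_sign H integrable I.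
  split=> // V HV intV; have [->|VI] := pselect (V = I); first by left.
  by right; apply: contrapT => VNI; apply: uI; exists V.
have [dI dJ dK] := frame_differentiable fr.
have [skJ|nskJ] := pselect (semi_kahler g J).
  have skK := semi_kahler_mul metric_g fr intI skJ.
  have [skI|nskI] := pselect (semi_kahler g I).
    by exists Type2; split; [exists I | exact: (semi_kahler_all fr skI skJ skK)].
  exists Type3 => /=; exists I; split=> // V HV.
  have [x [y [z [n1 ->]]]] := frame_coordinates fr HV.
  rewrite (orthogonal_lincomb3 m_gt0 M_nonempty _ _ _ fr); split=> [skV | x0].
    apply: contrapT => /eqP x0; apply: nskI.
    have -> : I = comb x^-1 (- x^-1) (lincomb3 x y z I J K) (comb y z J K).
      rewrite -[LHS](_ : comb (x^-1 * x) 0 I I = I); last by rewrite mulVf//; tensor_module.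
      by tensor_module.
    have dYZ := differentiable_comb (a := y) (b := z) dJ dK.
    have dV : differentiable_tensor (lincomb3 x y z I J K).
      rewrite lincomb3_comb; exact: (differentiable_comb dI dYZ).
    have skYZ := semi_kahler_comb metric_g y z dJ dK skJ skK.
    exact: (semi_kahler_comb metric_g _ _ dV dYZ skV skYZ).
  rewrite (_ : lincomb3 x y z I J K = comb y z J K); last by rewrite x0; tensor_module.
  exact: (semi_kahler_comb metric_g _ _ dJ dK skJ skK).
exists Type4 => /=; exists I, L.
have dL : differentiable_tensor L by rewrite LE; exact: differentiable_comb.
have LE3 : L = lincomb3 a b 0 I J K by rewrite LE; tensor_module.
have a0 : a != 0.
  apply/eqP => a0; apply: nskJ.
  have b2 : b * b = 1 by rewrite -expr2 -ab1 a0; ring.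
  have -> : J = comb b 0 L L.
    rewrite -[LHS](_ : comb (b * b) 0 J J = J); last by rewrite b2; tensor_module.
    by rewrite LE a0; tensor_module.
  exact: (semi_kahler_comb metric_g _ _ dL dL skL skL).
split=> //; last first.
  by rewrite LE3 (orthogonal_lincomb3 m_gt0 M_nonempty _ _ _ fr); exact/eqP.
split=> // V HV skV; have [x [y [z [n1 VE]]]] := frame_coordinates fr HV.
(* The combination of [V] and [L] that has no component along [I]. *)
have [E1 E2] : a * y - x * b = 0 /\ a * z = 0.
  apply: (semi_kahler_orthogonal fr) => //.
  rewrite (_ : comb _ _ J K = comb a (- x) V L); last by rewrite VE LE; tensor_module.
  have dV : differentiable_tensor V.
    rewrite VE lincomb3_comb; apply: (differentiable_comb dI).
    exact: differentiable_comb.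
  exact: (semi_kahler_comb metric_g _ _ dV dL skV skL).
have z0 : z = 0 by move/eqP: E2; rewrite mulf_eq0 (negbTE a0) => /eqP.
have xa : x ^+ 2 = a ^+ 2.
  have : a ^+ 2 * (x ^+ 2 + y ^+ 2 + z ^+ 2) = x ^+ 2 * (a ^+ 2 + b ^+ 2).
    have ay : a * y = x * b by apply/eqP; rewrite -subr_eq0 E1.
    rewrite z0 expr0n/= addr0 !mulrDr -!exprMn ay (mulrC a x).
    by rewrite exprMn.
  by rewrite n1 ab1 !mulr1.
move/eqP: xa; rewrite eqf_sqr => /orP[] /eqP xa; [left|right].
  have -> : V = lincomb3 a b 0 I J K; last by rewrite LE3.
  rewrite VE z0 xa; congr lincomb3; apply: (mulfI a0).
  by apply/eqP; rewrite -subr_eq0 -E1 xa.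
rewrite VE z0 xa LE3 (_ : y = - b); first by tensor_module.
apply: (mulfI a0); apply/eqP; rewrite -subr_eq0 -E1 xa; apply/eqP; ring.
Qed.

End Classification.

Theorem theorem4p3 (R : realType) (n : nat) (M : smoothManifold R (4 * n))
  (H : set (tensor2 M)) (g : tensor2 M)
  (n_gt0 : (0 < n)%N) (M_nonempty : [set: M] !=set0)
  (hypH : almost_hyperhermitian H g)
  (semiH : semi_integrable H g) :
  exists! t : structure_type, of_type H g t.
Proof.
have m_gt0 : (0 < 4 * n)%N by rewrite muln_gt0.
have [_ metric_g _] := hypH.
have [t Ht] := of_type_exists m_gt0 M_nonempty metric_g hypH semiH.
have [I [J [K fr]]] := frame_exists hypH.
by exists t; split=> // u; exact: of_type_inj fr Ht.
Qed.
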